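(* Let $n\geq 1$ and $1\leq k\leq n$ be integers and let $R>0$. Let $\Phi:\mathbb{R}^{2n}\to\mathbb{R}^{2n}$ be a linear symplectic automorphism (that is, a linear automorphism with $\Phi^{*}\Omega=\Omega$ as forms), and let $P:\mathbb{R}^{2n}\to\mathbb{R}^{2n}$ be the orthogonal projector onto a complex linear subspace $V\subset\mathbb{R}^{2n}$ of real dimension $2k$. Then \[ \mathrm{vol}_{2k}\bigl(P\Phi(B^{2n}(R))\bigr)\geq \omega_{2k}R^{2k}, \] and equality holds if and only if the linear subspace $\Phi^{T}V$ is complex, where $\Phi^{T}$ denotes the adjoint of $\Phi$ with respect to the Euclidean inner product.
   Context: $\mathbb{R}^{2n}$ is the Euclidean space with coordinates $(q_1,p_1,\dots,q_n,p_n)$, endowed with the standard symplectic form $\Omega=\sum_{j=1}^n dp_j\wedge dq_j$ and with the complex structure given by the identification $(q_1,p_1,\dots,q_n,p_n)\equiv(q_1+ip_1,\dots,q_n+ip_n)\in\mathbb{C}^n$. A real linear subspace is called complex if it is invariant under multiplication by $i$. $B^{2n}(R)$ is the open ball of radius $R$ about the origin in $\mathbb{R}^{2n}$. $\mathrm{vol}_{2k}$ is the Euclidean $2k$-dimensional volume in the $2k$-dimensional subspace $V$, and $\omega_{2k}$ is the $2k$-volume of the unit ball of $\mathbb{R}^{2k}$. *)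

(* Defs.v *)
From HB Require Import structures.
From mathcomp Require Import all_boot all_order all_algebra.
From mathcomp Require Import all_classical all_reals all_analysis.

Set Implicit Arguments.
Unset Strict Implicit.
Unset Printing Implicit Defensive.

Import Order.TTheory GRing.Theory Num.Theory.

Local Open Scope classical_set_scope.
Local Open Scope ring_scope.

(** The norm [`|x|] that the library puts on ['rV[R]_d] is the sup norm, so the
    Euclidean norm is defined separately. *)

Definition dot (R : realType) (d : nat) (x y : 'rV[R]_d) : R :=
  \sum_i x 0 i * y 0 i.

Definition enorm (R : realType) (d : nat) (x : 'rV[R]_d) : R :=
  Num.sqrt (dot x x).

Definition eball (R : realType) (d : nat) (r : R) : set 'rV[R]_d :=
  [set x | enorm x < r].
Arguments eball {R} d r.

(** ['End] acts on row vectors, [lin1_mx f] being the matrix with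
    [x *m lin1_mx f = f x]; [adjointE] is the defining property. *)
Definition adjoint (R : realType) (d : nat) (f : 'End('rV[R]_d)) :
  'End('rV[R]_d) := linfun (mulmxr (lin1_mx f)^T).

Lemma adjointE (R : realType) (d : nat) (f : 'End('rV[R]_d)) (x y : 'rV[R]_d) :
  dot (f x) y = dot x (adjoint f y).
Proof.
have dotE (u v : 'rV[R]_d) : dot u v = (u *m v^T) 0 0.
  by rewrite mxE; apply: eq_bigr => i _; rewrite mxE.
by rewrite !dotE lfunE /= trmx_mul trmxK mulmxA mul_rV_lin1.
Qed.

Definition is_orthogonal_projector (R : realType) (d : nat)
    (V : {vspace 'rV[R]_d}) (P : 'End('rV[R]_d)) : Prop :=
  forall x, P x \in V /\ (forall v, v \in V -> dot (x - P x) v = 0).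

(** The library has Lebesgue measure on [R] only.  On R^d we take the Lebesgue
    outer measure, i.e. the infimum of the total volumes of the countable covers
    by half-open boxes; it restricts to Lebesgue measure on measurable sets. *)

Definition box (R : realType) (d : nat) (a b : 'rV[R]_d) : set 'rV[R]_d :=
  [set x | forall i, a 0 i < x 0 i <= b 0 i].

Definition box_cover (R : realType) (d : nat) (A : set 'rV[R]_d) :
    set (nat -> 'rV[R]_d * 'rV[R]_d) :=
  [set F : nat -> 'rV[R]_d * 'rV[R]_d |
     (forall m i, (F m).1 0 i <= (F m).2 0 i) /\
     A `<=` \bigcup_m box (F m).1 (F m).2].

Definition lebesgue_vol (R : realType) (d : nat) (A : set 'rV[R]_d) : \bar R :=
  ereal_inf [set (\sum_(0 <= m <oo)
                    (\prod_i ((F m).2 0 i - (F m).1 0 i))%:E)%E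
            | F in box_cover A].

Definition orthonormal_basis (R : realType) (d m : nat)
    (V : {vspace 'rV[R]_d}) (e : m.-tuple 'rV[R]_d) : Prop :=
  basis_of V e /\ (forall i j : 'I_m, dot (tnth e i) (tnth e j) = (i == j)%:R).

(** The [m]-dimensional Euclidean volume in an [m]-dimensional subspace [V]: the
    Lebesgue measure of the coordinates in an orthonormal basis of [V].  By
    rotation invariance the value does not depend on the chosen basis; the
    default value of [xget] is irrelevant when [\dim V = m]. *)
Definition vol (R : realType) (d m : nat) (V : {vspace 'rV[R]_d})
    (A : set 'rV[R]_d) : \bar R :=
  let e := xget [tuple (0 : 'rV[R]_d) | _ < m] [set e | orthonormal_basis V e] in
  lebesgue_vol
    [set y : 'rV[R]_m | A (\sum_i y 0 i *: tnth e i)].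
Arguments vol {R d} m V A.

Definition omega (R : realType) (d : nat) : \bar R := lebesgue_vol (@eball R d 1).
Arguments omega R d : clear implicits.

(** ['rV_(n * 2)] is the row-major vectorisation of the [n x 2] matrices with
    rows (q_j, p_j), so its coordinates are (q_1, p_1, ..., q_n, p_n). *)

Definition qcoord (R : realType) (n : nat) (x : 'rV[R]_(n * 2)) (j : 'I_n) : R :=
  vec_mx x j 0.

Definition pcoord (R : realType) (n : nat) (x : 'rV[R]_(n * 2)) (j : 'I_n) : R :=
  vec_mx x j 1.

(** Omega = sum_j dp_j /\ dq_j *)
Definition Omega (R : realType) (n : nat) (x y : 'rV[R]_(n * 2)) : R :=
  \sum_j (pcoord x j * qcoord y j - qcoord x j * pcoord y j).

Definition symplectic_automorphism (R : realType) (n : nat)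
    (f : 'End('rV[R]_(n * 2))) : Prop :=
  bijective f /\ (forall x y, Omega (f x) (f y) = Omega x y).

(** Multiplication by [i] under x = (q_j + i p_j)_j : i (q + i p) = - p + i q. *)
Definition mul_i (R : realType) (n : nat) (x : 'rV[R]_(n * 2)) :
    'rV[R]_(n * 2) :=
  mxvec (\matrix_(j < n, c < 2) if c == 0 then - pcoord x j else qcoord x j).

Definition complex_subspace (R : realType) (n : nat)
    (V : {vspace 'rV[R]_(n * 2)}) : Prop :=
  forall x, x \in V -> mul_i x \in V.

(* Main.v *)
Require Import Defs.
From HB Require Import structures.
From mathcomp Require Import all_boot all_order all_algebra.
From mathcomp Require Import all_classical all_reals all_analysis.
From mathcomp Require Import measurable_realfun.
From mathcomp Require Import ring lra.

Set Implicit Arguments.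
Unset Strict Implicit.
Unset Printing Implicit Defensive.

Import Order.TTheory GRing.Theory Num.Theory.

Local Open Scope classical_set_scope.
Local Open Scope ring_scope.

(** Let [E] be the matrix whose rows are an orthonormal basis of [V], let [F]
    be the matrix of [Phi] and put [A = E F^T].  In the coordinates given by [E]
    the projected set is the image of the ball under [x |-> x A^T], an ellipsoid
    of volume [sqrt (det (A A^T)) * omega * r ^ 2k].  So the theorem says that
    the Gram determinant of [A] is at least [1], with equality exactly when the
    row space of [A], which is the adjoint image of [V], is complex.

    Let [J] be the matrix of the complex structure.  The transpose of a
    symplectic matrix is symplectic ([symplectic_tr]), so
    [A J A^T = E J E^T], and this matrix is orthogonal because [V] is complex.
    Gram-Schmidt ([gram_schmidt]) gives a triangular [T] with positive diagonal
    such that [Q = T A] has orthonormal rows; the Gram determinant of [A] is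
    then [(det T) ^ -2], and [Q J Q^T = T (E J E^T) T^T] has determinant
    [+- (det T) ^ 2].  But [Q J Q^T] is the compression of an orthogonal matrix
    to the row space of [Q]: its rows are orthogonal projections of unit
    vectors, so by Hadamard's inequality its determinant is at most [1] in
    absolute value, and it is [+- 1] only if none of these projections shortens
    its vector, that is, if the row space is stable under [J]
    ([det_compression]).  Hence [det T <= 1], with equality exactly in the
    complex case.

    It remains to see that the outer measure [lebesgue_vol] is multiplied by
    [(det T)^-1] when a set is pulled back along the triangular matrix [T^T]
    ([lebesgue_vol_trig]), and that [omega] is neither [0] nor [+oo], since
    otherwise equality of volumes would carry no information.  The first point
    reduces to diagonal matrices, which map boxes to boxes, and to shears, which
    are handled by cutting a box into thin slices; the second rests on the fact
    that a cube is not covered by boxes of smaller total volume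
    ([cube_cover_sum_ge1]). *)

(** * Outer volume: subadditivity and finite covers *)

Section Volume.
Variables (R : realType) (d : nat).
Implicit Types A B : set 'rV[R]_d.

Lemma lebesgue_vol_ge0 A : (0 <= lebesgue_vol A)%E.
Proof.
apply: le_ereal_inf_tmp => _ [F [Fle _] <-]; apply: nneseries_ge0 => m _ _.
by rewrite lee_fin; apply: prodr_ge0 => i _; rewrite subr_ge0.
Qed.

Lemma le_lebesgue_vol A B : A `<=` B -> (lebesgue_vol A <= lebesgue_vol B)%E.
Proof.
move=> AB; apply: ereal_inf_le_tmp => _ [F [Fle BF] <-].
by exists F => //; split => //; exact: subset_trans BF.
Qed.

(** The definition asks for an infinite sequence of boxes.  A finite family is
    padded with empty boxes, whose volume is [0] because [d] is positive: in
    dimension [0] it would be the empty product [1]. *)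
Lemma lebesgue_vol_le_boxes A (N : nat) (a b : nat -> 'rV[R]_d) : (0 < d)%N ->
    (forall k i, a k 0 i <= b k 0 i) ->
    (forall x, A x -> exists2 k, (k < N)%N & box (a k) (b k) x) ->
  (lebesgue_vol A <= (\sum_(k < N) \prod_i (b k 0 i - a k 0 i))%:E)%E.
Proof.
move=> d0 ab AN.
pose F k : 'rV[R]_d * 'rV[R]_d := if (k < N)%N then (a k, b k) else (0, 0).
have F0 k i : (F k).1 0 i <= (F k).2 0 i.
  by rewrite /F; case: ifP => _ /=; rewrite ?ab // mxE.
have v0 k : (0 <= (\prod_i ((F k).2 0 i - (F k).1 0 i))%:E)%E.
  by rewrite lee_fin; apply: prodr_ge0 => i _; rewrite subr_ge0.
apply: ge_ereal_inf.
exists (\sum_(0 <= k <oo) (\prod_i ((F k).2 0 i - (F k).1 0 i))%:E)%E.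
  exists F => //; split=> // x /AN[k kN xk].
  by exists k => //; rewrite /F kN.
rewrite (nneseries_split 0 N) // add0n big_mkord.
rewrite eseries0 ?adde0 => [|k Nk _].
  rewrite sumEFin lee_fin le_eqVlt; apply/orP; left; apply/eqP.
  by apply: eq_bigr => k _; rewrite /F ltn_ord.
by rewrite /F ltnNge Nk (bigD1 (Ordinal d0)) //= !mxE subrr mul0r.
Qed.

(** The usual argument: each set is covered up to an error [e / 2 ^ n.+1], and
    the covers are merged along a bijection of [nat] with [nat * nat]. *)
Lemma lebesgue_vol_sigma_subadditive (A : nat -> set 'rV[R]_d) :
  (lebesgue_vol (\bigcup_k A k) <= \sum_(0 <= k <oo) lebesgue_vol (A k))%E.
Proof.
have [[i ioo]|] := pselect (exists i, lebesgue_vol (A i) = +oo%E).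
  rewrite (eseries_pinfty _ _ ioo) ?leey// => n _.
  by rewrite -ltNye (lt_le_trans _ (lebesgue_vol_ge0 _)).
rewrite -forallNE => Aoo.
apply/lee_addgt0Pr => e e0.
rewrite (le_trans _ (epsilon_trick _ _ (ltW e0)))//; last first.
  by move=> n; exact: lebesgue_vol_ge0.
pose v (c : 'rV[R]_d * 'rV[R]_d) : R := \prod_i (c.2 0 i - c.1 0 i).
pose P n F := box_cover (A n) F /\
  (\sum_(0 <= m <oo) (v (F m))%:E
     <= lebesgue_vol (A n) + (e / (2 ^ n.+1)%:R)%:E)%E.
have [G PG] : {G & forall n, P n (G n)}.
  apply: (@choice _ _ P) => n.
  have e2 : 0 < e / (2 ^ n.+1)%:R by rewrite divr_gt0 // ltr0n expn_gt0.
  have fin : lebesgue_vol (A n) \is a fin_num.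
    by rewrite ge0_fin_numE ?lebesgue_vol_ge0 // ltey; apply/eqP/Aoo.
  have [_ [F FA <-] /ltW le] := lb_ereal_inf_adherent e2 fin.
  by exists F.
have vG0 (x : nat * nat) : (0 <= (v (G x.1 x.2))%:E)%E.
  case: x => n m; rewrite lee_fin; apply: prodr_ge0 => i _.
  by rewrite subr_ge0; exact: (PG n).1.1.
apply: (@le_trans _ _ (\esum_(x in setT) (v (G x.1 x.2))%:E)).
  apply: ge_ereal_inf; eexists; last exact: lexx.
  have /card_esym/ppcard_eqP[f] := card_nat2.
  exists (fun m => G (f m).1 (f m).2).
    split => [m i|].
      by rewrite /=; case: (f m) => n l; exact: (PG n).1.1.
    move=> t [n _ /(PG n).1.2 [m _ tnm]].
    by exists (f^-1%FUN (n, m)) => //=; rewrite invK ?inE.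
  rewrite nneseries_esumT; last by move=> n /=; apply: vG0.
  by rewrite (reindex_esum setT setT f (fun x => (v (G x.1 x.2))%:E)).
rewrite (_ : setT = setT `*`` (fun _ => setT)); last first.
  by apply/seteqP; split => -[].
rewrite -(@esum_esum _ _ _ setT (fun=> setT) (fun n m => (v (G n m))%:E)); last first.
  by move=> n m _ _; exact: (vG0 (n, m)).
rewrite -nneseries_esumT; last first.
  by move=> n; apply: esum_ge0 => m _; exact: (vG0 (n, m)).
apply: lee_nneseries => n _.
  by move=> _; apply: esum_ge0 => m _; exact: (vG0 (n, m)).
rewrite -nneseries_esumT; first exact: (PG n).2.
by move=> m; exact: (vG0 (n, m)).
Qed.

End Volume.
(** * Volume under triangular linear maps *)

Section LinearChange.
Variables (R : realType) (d : nat).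
Hypothesis d0 : (0 < d)%N.
Implicit Types (S : set 'rV[R]_d) (U : 'M[R]_d).

(** By subadditivity, a bound on the preimages of boxes passes to all sets. *)
Lemma lebesgue_vol_preimage_le (f : 'rV[R]_d -> 'rV[R]_d) (c : R) : 0 < c ->
    (forall a b : 'rV[R]_d, (forall i, a 0 i <= b 0 i) ->
      (lebesgue_vol (f @^-1` box a b) <= (c * \prod_i (b 0 i - a 0 i))%:E)%E) ->
  forall S, (lebesgue_vol (f @^-1` S) <= c%:E * lebesgue_vol S)%E.
Proof.
move=> c0 fbox S; rewrite -lee_pdivrMl //.
apply: le_ereal_inf_tmp => _ [F [Fle SF] <-]; rewrite lee_pdivrMl //.
have Fv m : (0 <= (\prod_i ((F m).2 0 i - (F m).1 0 i))%:E)%E.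
  by rewrite lee_fin; apply: prodr_ge0 => i _; rewrite subr_ge0.
rewrite -nneseriesZl //.
apply: (@le_trans _ _ (lebesgue_vol (\bigcup_m (f @^-1` box (F m).1 (F m).2)))).
  by apply: le_lebesgue_vol; rewrite -preimage_bigcup; exact: preimage_subset.
apply: le_trans (lebesgue_vol_sigma_subadditive _) _.
apply: lee_nneseries => m _; first by move=> _; exact: lebesgue_vol_ge0.
by rewrite -EFinM; exact: fbox.
Qed.

(** The preimage of a box is a box, which gives one inequality; the other one is
    the same inequality for the inverse matrix. *)
Lemma lebesgue_vol_diag (e : 'rV[R]_d) S : (forall i, 0 < e 0 i) ->
  lebesgue_vol ((mulmxr (diag_mx e)) @^-1` S)
    = ((\prod_i e 0 i)^-1%:E * lebesgue_vol S)%E.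
Proof.
have le (u : 'rV[R]_d) S' : (forall i, 0 < u 0 i) ->
    (lebesgue_vol ((mulmxr (diag_mx u)) @^-1` S')
      <= (\prod_i u 0 i)^-1%:E * lebesgue_vol S')%E.
  move=> u0; apply: lebesgue_vol_preimage_le.
    by rewrite invr_gt0; apply: prodr_gt0.
  move=> a b ab.
  pose dil (x : 'rV[R]_d) : 'rV[R]_d := \row_i (x 0 i / u 0 i).
  apply: le_trans (@lebesgue_vol_le_boxes _ _ _ 1 (fun=> dil a) (fun=> dil b) d0 _ _) _.
  - by move=> _ i; rewrite !mxE ler_pM2r ?invr_gt0.
  - move=> x xab; exists 0%N => // i; have := xab i.
    by rewrite /= mul_mx_diag !mxE ltr_pdivrMr // ler_pdivlMr.
  rewrite big_ord1 lee_fin -prodfV -big_split /= le_eqVlt; apply/orP; left.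
  by apply/eqP/eq_bigr => i _; rewrite !mxE -mulrBl mulrC.
move=> e0; apply/eqP; rewrite eq_le le //=.
have e'0 i : 0 < (map_mx GRing.inv e) 0 i by rewrite mxE invr_gt0.
have ee0 : 0 < \prod_i e 0 i by apply: prodr_gt0.
rewrite lee_pdivrMl //.
have := le (map_mx GRing.inv e) ((mulmxr (diag_mx e)) @^-1` S) e'0.
rewrite (eq_bigr (fun i => (e 0 i)^-1)) => [|i _]; last by rewrite mxE.
rewrite prodfV invrK; congr (lebesgue_vol _ <= _)%E.
apply/funext => x /=; congr (S _); apply/rowP => i.
by rewrite !mul_mx_diag !mxE divfK // gt_eqF.
Qed.

(** Preimages rather than images, so that no invertibility is needed. *)
Definition volume_preserving U :=
  forall S, lebesgue_vol ((mulmxr U) @^-1` S) = lebesgue_vol S.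

Lemma volume_preserving1 : volume_preserving 1%:M.
Proof.
by move=> S; congr lebesgue_vol; apply/funext => x /=; rewrite mulmx1.
Qed.

Lemma volume_preservingM U U' :
  volume_preserving U -> volume_preserving U' -> volume_preserving (U *m U').
Proof.
move=> vU vU' S; rewrite -[RHS]vU' -[RHS]vU; congr lebesgue_vol.
by apply/funext => x /=; rewrite mulmxA.
Qed.

(** The shear adds [c * y_j] to the coordinate [y_i].  Cut a box into [N] slices
    of thickness [h] in the direction [j].  On one slice the added term varies
    by at most [|c| h] around a constant, so the sheared slice lies in a box
    that is wider by [2 |c| h] in the direction [i] only.  The total excess
    volume is [O(1 / N)], whence one inequality; the opposite shear gives the
    other one. *)
Lemma volume_preserving_shear (j i : 'I_d) (c : R) : j != i ->
  volume_preserving (1%:M + c *: delta_mx j i).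
Proof.
move=> ji.
have shE c' (y : 'rV[R]_d) l :
    (y *m (1%:M + c' *: delta_mx j i)) 0 l = y 0 l + (c' * y 0 j) *+ (l == i).
  rewrite mulmxDr mulmx1 -scalemxAr [LHS]mxE [X in _ + X]mxE; congr (_ + _).
  rewrite [X in _ * X = _]mxE (bigD1 j) //= big1 => [|k kj].
    by rewrite mxE eqxx addr0 /=; case: eqP; rewrite (mulr1, mulr0) ?mulr0.
  by rewrite mxE (negbTE kj) mulr0.
have le c' S : (lebesgue_vol ((mulmxr (1%:M + c' *: delta_mx j i)) @^-1` S)
    <= lebesgue_vol S)%E.
  rewrite -[leRHS]mul1e; apply: lebesgue_vol_preimage_le => // a b ab.
  rewrite mul1r.
  pose w l := b 0 l - a 0 l.
  have w0 l : 0 <= w l by rewrite subr_ge0.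
  pose K := \prod_(l | (l != i) && (l != j)) w l.
  have K0 : 0 <= K by apply: prodr_ge0.
  have wE (u : 'I_d -> R) : \prod_l u l =
      u i * (u j * \prod_(l | (l != i) && (l != j)) u l).
    by rewrite (bigD1 i) //= (bigD1 j).
  suff leN N : (0 < N)%N ->
      (lebesgue_vol ((mulmxr (1%:M + c' *: delta_mx j i)) @^-1` box a b)
        <= (\prod_l w l + 2 * `|c'| * w j ^+ 2 * K / N%:R)%:E)%E.
    apply/lee_addgt0Pr => e e0.
    have C0 : 0 <= 2 * `|c'| * w j ^+ 2 * K.
      by rewrite !mulr_ge0 // sqr_ge0.
    have := archi_boundP (divr_ge0 C0 (ltW e0)).
    set N := Num.bound _ => CN.
    have N0 : (0 < N)%N.
      by rewrite -(ltr_nat R) (le_lt_trans _ CN) // divr_ge0 // ltW.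
    apply: le_trans (leN N N0) _; rewrite -EFinD lee_fin lerD2l.
    rewrite ler_pdivrMr ?ltr0n // -ler_pdivrMl // [leLHS]mulrC.
    exact: ltW.
  move=> N0.
  have NR : 0 < N%:R :> R by rewrite ltr0n.
  pose h := w j / N%:R.
  have h0 : 0 <= h by rewrite divr_ge0 // ltW.
  pose s (t : nat) := a 0 j + t%:R * h.
  pose al t : 'rV[R]_d := \row_l (if l == i then a 0 i - c' * s t - `|c'| * h
    else if l == j then s t else a 0 l).
  pose be t : 'rV[R]_d := \row_l (if l == i then b 0 i - c' * s t + `|c'| * h
    else if l == j then s t + h else b 0 l).
  have ch0 : 0 <= `|c'| * h by rewrite mulr_ge0.
  apply: le_trans (@lebesgue_vol_le_boxes _ _ _ N al be d0 _ _) _.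
  - move=> t l; rewrite !mxE; case: eqP => _; last by have := ab l; case: eqP => _; lra.
    by have := ab i; lra.
  - move=> y yab.
    have yl l : l != i -> a 0 l < y 0 l <= b 0 l.
      by move=> li; have := yab l; rewrite /= shE (negbTE li) addr0.
    have /andP[ayj yjb] := yl j ji.
    have hp : 0 < h by rewrite divr_gt0 // /w; lra.
    (* [y] lies in the slice that precedes the first cut point above [y_j] *)
    have exN : exists n : nat, y 0 j <= s n.
      by exists N; rewrite /s /h mulrC divfK ?gt_eqF // /w; lra.
    case: (ex_minnP exN) => -[|t] yt tmin.
      by move: yt; rewrite /s mul0r addr0 leNgt ayj.
    have styj : s t < y 0 j.
      by rewrite ltNge; apply/negP => /tmin; rewrite ltnn.
    have st1 : s t.+1 = s t + h by rewrite /s -natr1 mulrDl mul1r addrA.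
    rewrite st1 in yt.
    exists t.
      rewrite -(ltr_nat R) -(ltr_pM2r hp).
      have -> : N%:R * h = w j by rewrite /h mulrC divfK ?gt_eqF.
      by move: styj; rewrite /s /w; lra.
    move=> l; rewrite !mxE; have [->|li] := eqVneq l i.
      have := yab i; rewrite /= shE eqxx mulr1n.
      have : `|c' * (y 0 j - s t)| <= `|c'| * h.
        by rewrite normrM ler_wpM2l // ger0_norm; lra.
      rewrite ler_norml mulrBr; lra.
    have [->|lj] := eqVneq l j; first by lra.
    exact: yl.
  rewrite lee_fin [leLHS](eq_bigr (fun=> (w i + 2 * `|c'| * h) * (h * K))) => [|t _].
    rewrite sumr_const card_ord wE -/K -mulr_natl.
    have -> : h = w j / N%:R by [].
    rewrite le_eqVlt; apply/orP; left; apply/eqP.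
    field; exact: lt0r_neq0.
  rewrite wE !mxE eqxx (negbTE ji) eqxx; congr (_ * (_ * _)).
  - by rewrite /w; ring.
  - by ring.
  - apply: eq_bigr => l /andP[li lj].
    by rewrite !mxE (negbTE li) (negbTE lj).
move=> S; apply/eqP; rewrite eq_le le //=.
apply: le_trans (le (- c) _); rewrite le_eqVlt; apply/orP; left; apply/eqP.
congr lebesgue_vol; apply/funext => y /=; congr (S _); apply/rowP => l.
rewrite !shE (negbTE ji) addr0 -addrA -mulrnDl.
by rewrite mulNr addNr mul0rn addr0.
Qed.

(** Shears that read the same coordinate [t] commute and their off-diagonal
    parts add up, because [t] itself is left unchanged. *)
Lemma volume_preserving_row_shear (t : 'I_d) (v : 'I_d -> R) (s : seq 'I_d) :
  volume_preserving (1%:M + \sum_(j <- s | j != t) v j *: delta_mx t j).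
Proof.
elim: s => [|j s IH]; first by rewrite big_nil addr0; exact: volume_preserving1.
rewrite big_cons; case: ifP => // jt.
set X := \sum_(_ <- s | _) _ in IH *.
have -> : 1%:M + (v j *: delta_mx t j + X)
    = (1%:M + v j *: delta_mx t j) *m (1%:M + X).
  have X0 : v j *: delta_mx t j *m X = 0.
    rewrite -scalemxAl mulmx_sumr big1 ?scaler0 // => k kt.
    by rewrite -scalemxAr mul_delta_mx_cond (negbTE jt) mulr0n scaler0.
  by rewrite mulmxDr mulmx1 mulmxDl mul1mx X0 addr0 addrA.
by apply: volume_preservingM => //; apply: volume_preserving_shear; rewrite eq_sym jt.
Qed.

(** By induction on the number [t] of rows that may differ from those of the
    identity: the last such row is split off as a row shear on the right, whose
    support lies in the columns before it. *)
Lemma volume_preserving_unitrig U :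
  is_trig_mx U -> (forall i, U i i = 1) -> volume_preserving U.
Proof.
move=> Utrig U1.
suff main t (U' : 'M[R]_d) :
    (t <= d)%N -> is_trig_mx U' -> (forall i, U' i i = 1) ->
    (forall i j : 'I_d, (t <= i)%N -> U' i j = (i == j)%:R) ->
    volume_preserving U'.
  by apply: (main d) => // i j; rewrite leqNgt ltn_ord.
elim: t U' {U Utrig U1} => [|t IH] U td Utrig U1 Ut.
  rewrite (_ : U = 1%:M); first exact: volume_preserving1.
  by apply/matrixP => i j; rewrite Ut // mxE.
pose ot := Ordinal td.
pose L : 'M[R]_d := \matrix_(i, j) if i == ot then (i == j)%:R else U i j.
have -> : U = L *m
    (1%:M + \sum_(j <- index_enum 'I_d | j != ot) U ot j *: delta_mx ot j).
  apply/matrixP => i k; rewrite mulmxDr mulmx1 mulmx_sumr [RHS]mxE summxE.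
  under eq_bigr => j jt.
    rewrite -scalemxAr mxE [X in _ * X]mxE (bigD1 ot) //= big1 => [|l lt]; last first.
      by rewrite !mxE (negbTE lt) mulr0.
    rewrite addr0 [delta_mx _ _ _ _]mxE eqxx /=.
    over.
  have /is_trig_mxP Utr := Utrig.
  rewrite [L i ot]mxE [L i k]mxE; have [->|it] := eqVneq i ot.
    have [->|kt] := eqVneq k ot.
      rewrite big1 ?addr0 ?U1 // => j jt.
      by rewrite eq_sym (negbTE jt) !mulr0.
    rewrite add0r (bigD1 k) //= eqxx !mulr1 big1 ?addr0 // => j.
    by move=> /andP[_ jk]; rewrite eq_sym (negbTE jk) !mulr0.
  have -> : U i ot = 0.
    have [lt|gt|/val_inj eq] := ltngtP i ot; first exact: Utr.
      by rewrite Ut // (negbTE it).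
    by rewrite eq eqxx in it.
  by rewrite big1 ?addr0 // => j _; rewrite mul0r mulr0.
apply: volume_preservingM; last exact: volume_preserving_row_shear.
apply: IH; first exact: ltnW.
- apply/is_trig_mxP => i j ij; rewrite mxE; case: ifP => [_|_].
    by rewrite (ltn_eqF ij : (i == j) = false).
  by move/is_trig_mxP: Utrig => ->.
- by move=> i; rewrite mxE eqxx U1 if_same.
- move=> i j ti; rewrite mxE; case: eqP => // /eqP it.
  apply: Ut; rewrite ltn_neqAle ti andbT; apply: contra it => /eqP ti'.
  by apply/eqP/val_inj.
Qed.

(** A lower triangular matrix is a unit triangular one times its diagonal. *)
Lemma lebesgue_vol_trig U S : is_trig_mx U -> (forall i, 0 < U i i) ->
  lebesgue_vol ((mulmxr U) @^-1` S) = ((\det U)^-1%:E * lebesgue_vol S)%E.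
Proof.
move=> Utrig U0.
pose D : 'rV[R]_d := \row_i U i i.
pose L : 'M[R]_d := \matrix_(i, j) (U i j / U j j).
have UE : U = L *m diag_mx D.
  by apply/matrixP => i j; rewrite mul_mx_diag !mxE divfK // gt_eqF.
have vL : volume_preserving L.
  apply: volume_preserving_unitrig => [|i]; last by rewrite mxE divff // gt_eqF.
  apply/is_trig_mxP => i j ij; rewrite mxE.
  by move/is_trig_mxP: Utrig => ->; rewrite ?mul0r.
rewrite det_trig // (eq_bigr (D 0)) => [|i _]; last by rewrite mxE.
rewrite -lebesgue_vol_diag => [|i]; last by rewrite mxE.
rewrite -[RHS]vL; congr lebesgue_vol; apply/funext => x /=.
by rewrite UE mulmxA.
Qed.

End LinearChange.
(** * Volume of balls *)

Section UnitBall.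
Variable R : realType.

(** Slice the unit cube along its last coordinate [t].  The boxes that meet the
    slice at [t], restricted to it, cover a cube of one dimension less, so by
    induction their lower-dimensional volumes add up to at least [1].
    Integrating this over [t] multiplies each lower-dimensional volume by at
    most the last side of its box.  The predicate [P], which selects the boxes
    in use, is what makes the induction go through; coordinates are indexed by
    [nat] so that the dimension can vary. *)
Lemma cube_cover_sum_ge1 (n : nat) (a b : nat -> nat -> R) (P : pred nat) :
    (forall m i, a m i <= b m i) ->
    (forall x : nat -> R, (forall i, (i < n)%N -> 0 < x i <= 1) ->
      exists2 m, P m & forall i, (i < n)%N -> a m i < x i <= b m i) ->
  (1 <= \sum_(0 <= m <oo | P m) (\prod_(i < n) (b m i - a m i))%:E)%E.
Proof.
move=> ab; have v0 k m : 0 <= \prod_(i < k) (b m i - a m i).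
  by apply: prodr_ge0 => i _; rewrite subr_ge0.
elim: n P => [|n IH] P cov.
  have [m Pm _] := cov (fun=> 1) (fun _ => ltac:(by [])).
  rewrite (@nneseriesD1 _ _ m) // => [|k _]; last by rewrite lee_fin.
  by rewrite big_ord0 leeDl // nneseries_ge0 // => k _ _; rewrite lee_fin.
pose D : set R := `]0, 1]%classic.
pose c m := if P m then \prod_(i < n) (b m i - a m i) else 0.
have c0 m : 0 <= c m by rewrite /c; case: ifP.
pose I m := `]a m n, b m n]%classic : set R.
pose f m t := ((c m)%:E * (\1_(I m) t)%:E)%E.
have f0 m t : (0 <= f m t)%E by rewrite mule_ge0 // lee_fin.
have mI m : measurable_fun D (EFin \o \1_(I m)).
  by apply/measurable_EFinP/measurable_indic; exact: measurable_itv.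
have mf m : measurable_fun D (f m).
  by apply: measurable_funeM; exact: mI.
have slice t : D t -> (1 <= \sum_(0 <= m <oo) f m t)%E.
  rewrite /D /= in_itv /= => t01.
  have := IH [pred m | P m && (a m n < t <= b m n)].
  rewrite eseries_mkcond => le1.
  apply: le_trans (le1 _) _; last first.
    rewrite le_eqVlt; apply/orP; left; apply/eqP; apply: eq_eseriesr => m _.
    rewrite /f /c indicE /I mem_setE in_itv /=.
    by case: (P m); case: (_ < _ <= _); rewrite /= ?mule1 ?mule0.
  move=> x x01.
  have [i ilt|m Pm xm] := cov (fun i => if i == n then t else x i).
    case: eqVneq => // ni; apply: x01.
    by rewrite ltn_neqAle ni -ltnS.
  exists m => [|i ilt].
    by rewrite /= Pm; have := xm n (ltnSn n); rewrite eqxx.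
  by have := xm i (ltnW ilt); rewrite (ltn_eqF ilt).
have mD : measurable D by exact: measurable_itv.
have : (\int[lebesgue_measure]_(t in D) (cst 1 t)
    <= \int[lebesgue_measure]_(t in D) \sum_(0 <= m <oo) f m t)%E.
  apply: ge0_le_integral => //.
  by apply: (@ge0_emeasurable_sum _ _ _ D f xpredT).
have muD : lebesgue_measure D = 1%E.
  by rewrite lebesgue_measure_itv /= lte_fin ltr01 oppr0 adde0.
rewrite integral_cst // mul1e.
move=> le1; rewrite -[leLHS]muD; apply: (le_trans le1).
rewrite integral_nneseries // [leRHS]eseries_mkcond.
apply: lee_nneseries => m _; first by move=> _; exact: integral_ge0.
rewrite ge0_integralZl_EFin //; last exact: mI.
rewrite integral_indic //; last exact: measurable_itv.
have leI : (lebesgue_measure (I m `&` D) <= (b m n - a m n)%:E)%E.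
  have ab' := ab m n.
  apply: (@le_trans _ _ (lebesgue_measure (I m))).
    by apply: le_measure; rewrite ?inE //; [apply: measurableI|]; exact: measurable_itv.
  rewrite lebesgue_measure_itv /= lte_fin; case: ifP => _ //.
  by rewrite lee_fin subr_ge0.
apply: le_trans (lee_wpmul2l _ leI) _; first by rewrite lee_fin.
rewrite -EFinM /c; case: (P m); last by rewrite mul0r.
by rewrite big_ord_recr.
Qed.

Variable d : nat.
Hypothesis d0 : (0 < d)%N.

Lemma lebesgue_vol_unit_cube_ge1 :
  (1 <= lebesgue_vol (box (0 : 'rV[R]_d)%R (const_mx 1)%R))%E.
Proof.
case: d d0 => // d' _.
apply: le_ereal_inf_tmp => _ [F [Fle cov] <-].
pose a m i : R := (F m).1 0 (inord i); pose b m i : R := (F m).2 0 (inord i).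
rewrite (eq_eseriesr (g := fun m => (\prod_(i < d'.+1) (b m i - a m i))%:E)).
  2: by move=> m _; congr EFin; apply: eq_bigr => i _; rewrite /a /b inord_val.
apply: cube_cover_sum_ge1 => [m i|x x01]; first exact: Fle.
have [|m _ xm] := cov (\row_i x i); first by move=> i; rewrite !mxE x01.
exists m => // i ilt.
by have := xm (inord i); rewrite mxE inordK.
Qed.

Lemma lebesgue_vol_eballZ (r : R) : 0 < r ->
  lebesgue_vol (@eball R d r) = (omega R d * (r ^+ d)%:E)%E.
Proof.
move=> r0.
have := @lebesgue_vol_diag R d d0 (const_mx r^-1) (@eball R d 1).
rewrite (eq_bigr (fun=> r^-1)) => [|i _]; last by rewrite mxE.
rewrite prodr_const card_ord -exprVn invrK => H.
rewrite muleC -H => [|i]; last by rewrite mxE invr_gt0.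
congr lebesgue_vol; apply/funext => x /=; rewrite /eball /= diag_const_mx mul_mx_scalar.
rewrite /enorm (_ : dot (r^-1 *: x) (r^-1 *: x) = r^-1 ^+ 2 * dot x x).
  by rewrite sqrtrM ?sqr_ge0 // sqrtr_sqr ger0_norm ?invr_ge0 ?ltW // ltr_pdivrMl // mulr1.
rewrite /dot mulr_sumr; apply: eq_bigr => i _; rewrite !mxE; ring.
Qed.

(** The unit ball contains the cube with side [1 / (d + 1)] in the positive
    orthant, since [d / (d + 1) ^ 2 < 1]. *)
Lemma omega_gt0 : (0 < omega R d)%E.
Proof.
have dR : 0 < (d.+1%:R : R) by rewrite ltr0n.
have := @lebesgue_vol_diag R d d0 (const_mx d.+1%:R) (box 0 (const_mx 1)).
move=> /(_ (fun i => ltac:(by rewrite mxE))) volE.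
pose cube : set 'rV[R]_d :=
  mulmxr (diag_mx (const_mx d.+1%:R)) @^-1` box 0 (const_mx 1).
apply: lt_le_trans (_ : (0 < lebesgue_vol cube)%E) _.
  rewrite /cube volE mule_gt0 ?lte_fin ?invr_gt0 ?prodr_gt0 // => [i _|].
    by rewrite mxE.
  exact: lt_le_trans lebesgue_vol_unit_cube_ge1.
apply: le_lebesgue_vol => x xbox; rewrite /eball /= /enorm.
rewrite -sqrtr1 ltr_sqrt // /dot.
apply: (@le_lt_trans _ _ (\sum_(i < d) d.+1%:R^-1)).
  apply: ler_sum => i _; have := xbox i.
  rewrite /= diag_const_mx mul_mx_scalar !mxE => /andP[].
  rewrite pmulr_rgt0 // => x0; rewrite mulrC -ler_pdivlMr // mul1r => xle.
  have d1 : d.+1%:R^-1 <= 1 :> R by rewrite invf_le1 // ler1n.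
  by rewrite -[leRHS]mulr1; apply: ler_pM (ltW x0) (ltW x0) xle (le_trans xle d1).
by rewrite sumr_const card_ord -[ltLHS]mulr_natr mulrC ltr_pdivrMr // mul1r ltr_nat.
Qed.

Lemma omega_fin : (omega R d < +oo)%E.
Proof.
pose a (_ : nat) : 'rV[R]_d := const_mx (-1).
pose b (_ : nat) : 'rV[R]_d := const_mx 1.
apply: le_lt_trans (ltry (\sum_(k < 1) \prod_i (b k 0 i - a k 0 i))).
apply: (@lebesgue_vol_le_boxes _ _ _ 1 a b) => //.
  by move=> k i; rewrite /a /b !mxE; lra.
move=> x x1; exists 0%N => // i; rewrite /a /b !mxE.
have xx : x 0 i ^+ 2 < 1.
  have {}x1 : dot x x < 1 by rewrite -ltr_sqrt // sqrtr1.
  apply: le_lt_trans x1; rewrite /dot (bigD1 i) //= -expr2 lerDl sumr_ge0 // => j _.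
  by rewrite -expr2 sqr_ge0.
have : `|x 0 i| < 1 by rewrite -sqrtr_sqr -sqrtr1 ltr_sqrt.
by rewrite ltr_norml => /andP[-> /ltW ->].
Qed.

End UnitBall.
(** * Gram-Schmidt, Hadamard and compressions *)

Section LinAlg.
Variable R : realType.

Lemma mulmx_tr_ge0 d (x : 'rV[R]_d) : 0 <= (x *m x^T) 0 0.
Proof. by rewrite mxE sumr_ge0 // => i _; rewrite mxE -expr2 sqr_ge0. Qed.

Lemma mulmx_tr_eq0 d (x : 'rV[R]_d) : ((x *m x^T) 0 0 == 0) = (x == 0).
Proof.
apply/eqP/eqP => [|->]; last by rewrite mul0mx mxE.
rewrite mxE => /psumr_eq0P H; apply/rowP => i; rewrite [RHS]mxE.
have /H/(_ i isT)/eqP : forall j : 'I_d, true -> 0 <= x 0 j * x^T j 0.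
  by move=> j _; rewrite mxE -expr2 sqr_ge0.
by rewrite mxE mulf_eq0 orbb => /eqP.
Qed.

Lemma row_dot m d (A B : 'M[R]_(m, d)) i j :
  (row i A *m (row j B)^T) 0 0 = (A *m B^T) i j.
Proof. by rewrite !mxE; apply: eq_bigr => l _; rewrite !mxE. Qed.

(** Pythagoras: when the rows of [Q] are orthonormal, [x Q^T] holds the
    coordinates of the orthogonal projection [x Q^T Q] of [x] to their span. *)
Lemma proj_pythagoras m d (Q : 'M[R]_(m, d)) (x : 'rV[R]_d) : Q *m Q^T = 1%:M ->
  let p := x *m Q^T *m Q in
  (x *m x^T) 0 0 =
    ((x *m Q^T) *m (x *m Q^T)^T) 0 0 + ((x - p) *m (x - p)^T) 0 0.
Proof.
move=> QQ p.
suff -> : x *m x^T = (x *m Q^T) *m (x *m Q^T)^T + (x - p) *m (x - p)^T.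
  by rewrite [LHS]mxE.
have pQ : p *m Q^T = x *m Q^T by rewrite /p -mulmxA QQ mulmx1.
have xp : x *m p^T = x *m Q^T *m (x *m Q^T)^T.
  by rewrite /p trmx_mul mulmxA.
have pp : p *m p^T = x *m Q^T *m (x *m Q^T)^T.
  by rewrite {2}/p trmx_mul mulmxA pQ.
have px : p *m x^T = x *m Q^T *m (x *m Q^T)^T.
  by rewrite [in RHS]trmx_mul trmxK mulmxA.
by rewrite linearB /= mulmxBl !mulmxBr xp pp px subrr subr0 addrC subrK.
Qed.

(** The rows are processed from the last to the first, so [T] is upper
    triangular; each diagonal entry is the inverse length of what remains of a
    row after its projection to the following rows is removed.  Removing a
    projection shortens a row, so [(det T)^-1], the product of the remaining
    lengths, is at most the product of the lengths of the rows of [A]: this is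
    the last clause, squared. *)
Lemma gram_schmidt m d (A : 'M[R]_(m, d)) : row_free A ->
  exists T : 'M[R]_m,
   [/\ is_trig_mx T^T, forall i, 0 < T i i, (T *m A) *m (T *m A)^T = 1%:M
     & 1 <= \det T ^+ 2 * \prod_i (A *m A^T) i i].
Proof.
elim: m => [|m IH] in A *.
  move=> _; exists 1%:M; split.
  - by apply/is_trig_mxP => -[].
  - by case.
  - by apply/matrixP => -[].
  - by rewrite det_mx00 big_ord0 mulr1 expr1n.
rewrite -[m.+1]/(1 + m)%N in A *; rewrite -(vsubmxK A).
set a := usubmx A; set A' := dsubmx A => Afree.
have /row_freeP[B] := Afree.
rewrite -(hsubmxK B) mul_col_row (scalar_mx_block 1 m 1).
move=> /eq_block_mx[aB aB' _ A'B].
have A'free : row_free A' by apply/row_freeP; exists (rsubmx B).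
have [T' [trigT' T'_gt0 ON' le']] := IH A' A'free.
set Q := T' *m A' in ON'.
set b := a - a *m Q^T *m Q.
have bQ : b *m Q^T = 0 by rewrite mulmxBl -[X in _ - X]mulmxA ON' mulmx1 subrr.
(* otherwise [a] is a combination [c A'] of the other rows; multiplied by the
   right part of the right inverse [B], it gives both [c] and [0], so [a = 0] *)
have b_neq0 : b != 0.
  apply/eqP => /subr0_eq; rewrite /Q mulmxA; set c := _ *m T' => aE.
  have c0 : c = 0 by rewrite -[c]mulmx1 -A'B mulmxA -aE.
  move/matrixP/(_ 0 0): aB; rewrite aE c0 !mul0mx !mxE eqxx.
  by move=> /eqP; rewrite eq_sym oner_eq0.
have bb_gt0 : 0 < (b *m b^T) 0 0.
  by rewrite lt_neqAle mulmx_tr_ge0 eq_sym mulmx_tr_eq0 b_neq0.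
set s := (Num.sqrt ((b *m b^T) 0 0))^-1.
have s_gt0 : 0 < s by rewrite invr_gt0 sqrtr_gt0.
have sE : s ^+ 2 * (b *m b^T) 0 0 = 1.
  by rewrite /s exprVn sqr_sqrtr ?ltW // mulVf // gt_eqF.
pose T : 'M[R]_(1 + m) := block_mx s%:M (- s *: (a *m Q^T *m T')) 0 T'.
have TA : T *m col_mx a A' = col_mx (s *: b) Q.
  rewrite mul_block_col mul0mx add0r mul_scalar_mx -scalemxAl -mulmxA -/Q.
  by rewrite scaleNr -scalerBr.
exists T; split.
- by rewrite tr_block_mx trmx0 is_trig_block_mx // eqxx mx11_is_trig.
- move=> i; case: (split_ordP i) => j ->.
    by rewrite block_mxEul !mxE ord1 eqxx.
  by rewrite block_mxEdr.
- have Qb : Q *m b^T = 0 by rewrite -[LHS]trmxK trmx_mul trmxK bQ trmx0.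
  rewrite TA tr_col_mx mul_col_row ON' linearZ /= -!scalemxAl -!scalemxAr bQ Qb.
  rewrite !scaler0 scalerA -expr2 [b *m b^T]mx11_scalar scale_scalar_mx sE.
  by rewrite -scalar_mx_block.
- rewrite det_ublock det_scalar1 tr_col_mx mul_col_row.
  rewrite (@big_split_ord _ _ _ 1 m) /= big_ord1 block_mxEul.
  under eq_bigr do rewrite block_mxEdr.
  rewrite exprMn mulrACA -[leLHS]mulr1.
  have aa : (b *m b^T) 0 0 <= (a *m a^T) 0 0.
    by rewrite (proj_pythagoras a ON') lerDr mulmx_tr_ge0.
  apply: ler_pM => //.
  by rewrite -sE ler_wpM2l // sqr_ge0.
Qed.

(** Hadamard's inequality: [det N * det T] is [+- 1] for the [T] of
    [gram_schmidt]. *)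
Lemma det_hadamard m (N : 'M[R]_m) :
  \det N ^+ 2 <= \prod_i (N *m N^T) i i.
Proof.
have [N0|Nunit] := eqVneq (\det N) 0.
  rewrite N0 expr0n /=; apply: prodr_ge0 => i _.
  by rewrite mxE sumr_ge0 // => j _; rewrite mxE -expr2 sqr_ge0.
have Nfree : row_free N by rewrite row_free_unit unitmxE unitfE.
have [T [_ _ ON le1]] := gram_schmidt Nfree.
have := congr1 determinant ON.
rewrite det_mulmx det_tr !det_mulmx det1 -expr2 exprMn => TN.
rewrite -[leLHS]mulr1 (le_trans (ler_wpM2l (sqr_ge0 _) le1)) // mulrA.
by rewrite [_ * \det T ^+ 2]mulrC TN mul1r.
Qed.

(** The rows of [Q J] are unit vectors and those of [N] are the coordinates of
    their projections to the row space of [Q], so they have length at most [1]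
    and Hadamard's inequality applies.  If the determinant is [+- 1], all these
    lengths are [1], so every row of [Q J] is its own projection.  Conversely,
    if [Q J = X Q] then [N = X], which is orthogonal. *)
Lemma det_compression m d (Q : 'M[R]_(m, d)) (J : 'M[R]_d) :
    Q *m Q^T = 1%:M -> J *m J^T = 1%:M ->
  let N := Q *m J *m Q^T in
  \det N ^+ 2 <= 1 /\ (\det N ^+ 2 = 1 <-> (Q *m J <= Q)%MS).
Proof.
move=> QQ JJ N.
have QJ1 : Q *m J *m (Q *m J)^T = 1%:M.
  by rewrite trmx_mul -mulmxA (mulmxA J) JJ mul1mx.
pose x i := row i (Q *m J).
have xx i : (x i *m (x i)^T) 0 0 = 1.
  by rewrite row_dot QJ1 mxE eqxx.
have NE i : (N *m N^T) i i = ((x i *m Q^T) *m (x i *m Q^T)^T) 0 0.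
  by rewrite -row_mul row_dot.
have Nle i : 0 <= (N *m N^T) i i <= 1.
  by rewrite NE mulmx_tr_ge0 -(xx i) (proj_pythagoras (x i) QQ) lerDl mulmx_tr_ge0.
split; first by apply: (le_trans (det_hadamard N)); apply: prodr_ile1 => i _.
split=> [N1|/submxP[X QJ]].
  apply/row_subP => i; rewrite -/(x i).
  have Ni : (N *m N^T) i i = 1.
    apply/eqP; rewrite eq_le (andP (Nle i)).2 -N1 /=.
    apply: (le_trans (det_hadamard N)); rewrite (bigD1 i) //=.
    rewrite -[leRHS]mulr1 ler_wpM2l ?(andP (Nle i)).1 //.
    by apply: prodr_ile1 => j _; exact: Nle.
  move: (proj_pythagoras (x i) QQ); rewrite xx -NE Ni => /eqP.
  rewrite -subr_eq0 opprD addrA subrr add0r oppr_eq0 mulmx_tr_eq0 subr_eq0.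
  by move=> /eqP ->; exact: submxMl.
have NX : N = X by rewrite /N QJ -mulmxA QQ mulmx1.
rewrite -(det1 _ m) -QJ1 QJ trmx_mul -mulmxA (mulmxA Q) QQ mul1mx.
by rewrite det_mulmx det_tr expr2 NX.
Qed.

End LinAlg.
(** * The complex structure and symplectic matrices *)

Section Symplectic.
Variables (R : realType) (n : nat).
Implicit Types x y : 'rV[R]_(n * 2).

Lemma dot_mulmx d (x y : 'rV[R]_d) : dot x y = (x *m y^T) 0 0.
Proof. by rewrite mxE; apply: eq_bigr => i _; rewrite mxE. Qed.

Lemma dot_coord x y :
  dot x y = \sum_j (qcoord x j * qcoord y j + pcoord x j * pcoord y j).
Proof.
rewrite /dot (reindex _ (curry_mxvec_bij n 2)) /=.
pose f j c := x 0 (mxvec_index j c) * y 0 (mxvec_index j c).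
rewrite (eq_bigr (fun p => f p.1 p.2)) => [|[]] //.
rewrite -(pair_bigA _ f) /f /=.
apply: eq_bigr => j _.
have E (z : 'rV[R]_(n * 2)) c : z 0 (mxvec_index j c) = vec_mx z j c :> R.
  by rewrite -{1}(vec_mxK z) mxvecE.
rewrite big_ord_recl big_ord_recl big_ord0 addr0 !E /qcoord /pcoord.
by rewrite (_ : lift ord0 ord0 = 1) //; apply: val_inj.
Qed.

Lemma qcoord_mul_i x j : qcoord (mul_i x) j = - pcoord x j.
Proof. by rewrite /qcoord mxvecK mxE. Qed.

Lemma pcoord_mul_i x j : pcoord (mul_i x) j = qcoord x j.
Proof. by rewrite /pcoord mxvecK mxE. Qed.

Lemma mul_i_is_linear : linear (@mul_i R n).
Proof.
move=> c x y; rewrite /mul_i -linearP; congr mxvec.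
apply/matrixP => j l; rewrite !mxE; case: ifP => _; rewrite /pcoord /qcoord linearP !mxE //.
by rewrite opprD mulrN.
Qed.

HB.instance Definition _ := GRing.isLinear.Build R 'rV[R]_(n * 2) 'rV[R]_(n * 2)
  _ (@mul_i R n) mul_i_is_linear.

Definition imx : 'M[R]_(n * 2) := lin1_mx (@mul_i R n).

Lemma mul_imx x : x *m imx = mul_i x.
Proof. exact: mul_rV_lin1. Qed.

Lemma Omega_imx x y : Omega x y = (x *m (y *m imx)^T) 0 0.
Proof.
rewrite -dot_mulmx mul_imx dot_coord; apply: eq_bigr => j _.
by rewrite qcoord_mul_i pcoord_mul_i; ring.
Qed.

Lemma bilinear_inj d (M N : 'M[R]_d) :
  (forall x y : 'rV_d, (x *m M *m y^T) 0 0 = (x *m N *m y^T) 0 0) -> M = N.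
Proof.
move=> MN; apply/matrixP => i j; have := MN (delta_mx 0 i) (delta_mx 0 j).
by rewrite !trmx_delta -!colE -!rowE !mxE.
Qed.

Lemma imx_orthogonal : imx *m imx^T = 1%:M.
Proof.
apply: bilinear_inj => x y; rewrite mulmx1 mulmxA -[_ *m y^T]mulmxA -trmx_mul.
rewrite -!dot_mulmx !mul_imx !dot_coord; apply: eq_bigr => j _.
by rewrite !qcoord_mul_i !pcoord_mul_i; ring.
Qed.

Lemma tr_imx : imx^T = - imx.
Proof.
suff ii : imx *m imx = - 1%:M.
  by rewrite -[LHS]mul1mx -[1%:M]opprK -ii mulNmx -mulmxA imx_orthogonal mulmx1.
apply: bilinear_inj => x y; rewrite mulmxN mulmx1 mulNmx mulmxA !mul_imx.
rewrite [RHS]mxE -!dot_mulmx !dot_coord -sumrN; apply: eq_bigr => j _.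
rewrite !(qcoord_mul_i, pcoord_mul_i); ring.
Qed.

Lemma mul_imxN : imx *m - imx = 1%:M.
Proof. by rewrite -tr_imx imx_orthogonal. Qed.

(** Transposes of symplectic matrices are symplectic: [F J F^T = J] with
    [J (- J) = 1] exhibits [J F^T (- J)] as a right inverse of [F], and a right
    inverse of a square matrix is a left inverse. *)
Lemma symplectic_tr (F : 'M[R]_(n * 2)) :
  (forall x y, Omega (x *m F) (y *m F) = Omega x y) -> F^T *m imx *m F = imx.
Proof.
move=> FO.
have FJ : F *m imx *m F^T = imx.
  have : F *m imx^T *m F^T = imx^T.
    apply: bilinear_inj => x y.
    have := FO x y; rewrite !Omega_imx !trmx_mul !mulmxA.
    by rewrite -!mulmxA => ->; rewrite !mulmxA.
  by rewrite tr_imx mulmxN mulNmx => /oppr_inj.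
have : F *m (imx *m F^T *m - imx) = 1%:M by rewrite !mulmxA FJ mul_imxN.
move=> /mulmx1C; rewrite mulmxN mulNmx => iFiF.
by rewrite -[LHS]mul1mx -mul_imxN -mulmxA mulNmx !mulmxA iFiF mulmx1.
Qed.

Lemma complex_subspace_submx m (W : {vspace 'rV[R]_(n * 2)})
    (A : 'M[R]_(m, n * 2)) :
    (forall x, x \in W <-> (x <= A)%MS) ->
  complex_subspace W <-> (A *m imx <= A)%MS.
Proof.
move=> WA; split=> [Wi|AJ x /WA xA].
  apply/row_subP => i; rewrite row_mul mul_imx.
  by apply/WA/Wi/WA; exact: row_sub.
by apply/WA; rewrite -mul_imx (submx_trans _ AJ) // submxMr.
Qed.

End Symplectic.

(** * Orthonormal bases and orthogonal projectors *)

Section OrthonormalBasis.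
Variables (R : realType) (d m : nat).
Variables (V : {vspace 'rV[R]_d}) (dimV : \dim V = m).

Definition tuple_mx (e : m.-tuple 'rV[R]_d) : 'M[R]_(m, d) :=
  \matrix_i tnth e i.

Lemma mul_tuple_mx (e : m.-tuple 'rV[R]_d) (y : 'rV[R]_m) :
  y *m tuple_mx e = \sum_i y 0 i *: tnth e i.
Proof. by rewrite mulmx_sum_row; apply: eq_bigr => i _; rewrite rowK. Qed.

Lemma free_row_free (e : m.-tuple 'rV[R]_d) : free e = row_free (tuple_mx e).
Proof.
apply/idP/idP => [/freeP fe|fe].
  apply: inj_row_free => y; rewrite mul_tuple_mx => y0; apply/rowP => i.
  rewrite mxE; apply: fe i; rewrite -[RHS]y0.
  by apply: eq_bigr => i _; rewrite -tnth_nth.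
apply/freeP => y y0 i.
have : (\row_i y i) *m tuple_mx e = 0 *m tuple_mx e.
  rewrite mul0mx mul_tuple_mx -[RHS]y0.
  by apply: eq_bigr => j _; rewrite mxE -tnth_nth.
by move/(row_free_inj fe)/rowP/(_ i); rewrite !mxE.
Qed.

Lemma orthonormal_basis_exists :
  exists e : m.-tuple 'rV[R]_d, orthonormal_basis V e.
Proof.
have bV := vbasisP V; move: (vbasis V) bV; rewrite dimV => b bV.
have bfree : row_free (tuple_mx b) by rewrite -free_row_free (basis_free bV).
have [T [_ _ ON _]] := gram_schmidt bfree.
set Q := T *m tuple_mx b in ON.
pose e := [tuple row i Q | i < m].
have eQ : tuple_mx e = Q by apply/row_matrixP => i; rewrite rowK tnth_mktuple.
exists e; split; last first.
  by move=> i j; rewrite !tnth_mktuple dot_mulmx row_dot ON mxE.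
rewrite basisEfree free_row_free eQ size_tuple dimV leqnn andbT; apply/andP; split.
  by apply/row_freeP; exists Q^T.
apply/span_subvP => _ /tnthP[i ->]; rewrite tnth_mktuple row_mul mul_tuple_mx.
apply: memv_suml => j _; apply: memvZ.
by rewrite -(span_basis bV) memv_span // mem_tnth.
Qed.

Lemma orthonormal_basis_mx (e : m.-tuple 'rV[R]_d) : orthonormal_basis V e ->
  tuple_mx e *m (tuple_mx e)^T = 1%:M.
Proof.
move=> [_ ON]; apply/matrixP => i j.
by rewrite -row_dot -dot_mulmx !rowK ON mxE.
Qed.

Lemma mem_basis_submx (e : m.-tuple 'rV[R]_d) x : basis_of V e ->
  x \in V <-> (x <= tuple_mx e)%MS.
Proof.
move=> bV; split=> [xV|/submxP[y ->]].
  rewrite (coord_basis bV xV); apply: summx_sub => i _; apply: scalemx_sub.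
  by rewrite -tnth_nth -(rowK (tnth e)) row_sub.
rewrite mul_tuple_mx; apply: memv_suml => i _; apply: memvZ.
by rewrite -(span_basis bV) memv_span // mem_tnth.
Qed.

Lemma projectorE (P : 'End('rV[R]_d)) (e : m.-tuple 'rV[R]_d) x :
    is_orthogonal_projector V P -> orthonormal_basis V e ->
  P x = x *m (tuple_mx e)^T *m tuple_mx e.
Proof.
move=> Pproj ebasis; have [bV _] := ebasis; have [PV Pperp] := Pproj x.
have /submxP[y PE] := (mem_basis_submx (P x) bV).1 PV.
rewrite [LHS]PE; congr (_ *m _).
have : (x - P x) *m (tuple_mx e)^T = 0.
  apply/rowP => i; rewrite [RHS]mxE.
  rewrite -(Pperp (tnth e i)); last by rewrite -(span_basis bV) memv_span // mem_tnth.
  by rewrite dot_mulmx !mxE; apply: eq_bigr => l _; rewrite !mxE.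
rewrite mulmxBl PE -mulmxA (orthonormal_basis_mx ebasis) mulmx1.
by move/subr0_eq.
Qed.

End OrthonormalBasis.
(** * The volume of the projected ball *)

(** In coordinates the projected set is the image of the ball under
    [x |-> x A^T].  After the change of coordinates [T^T] this map becomes
    [x |-> x Q^T] with [Q = T A], which maps the ball onto the ball of the same
    radius: it does not increase lengths, and [z] is the image of [z Q], which
    has the same length as [z]. *)
Lemma projected_ball_preimage (R : realType) (d m : nat) (r : R)
    (V : {vspace 'rV[R]_d}) (Phi P : 'End('rV[R]_d)) (e : m.-tuple 'rV[R]_d)
    (T : 'M[R]_m) :
    is_orthogonal_projector V P -> orthonormal_basis V e ->
    let A := tuple_mx e *m (lin1_mx Phi)^T in
    T *m A *m (T *m A)^T = 1%:M ->
  [set y : 'rV[R]_m | (P @` (Phi @` eball d r)) (\sum_i y 0 i *: tnth e i)]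
    = (mulmxr T^T) @^-1` eball m r.
Proof.
move=> Pproj ebasis A; set Q := T *m A => QQ.
have EE := orthonormal_basis_mx ebasis.
have PPhi x : P (Phi x) = x *m A^T *m tuple_mx e.
  by rewrite (projectorE _ Pproj ebasis) -(mul_rV_lin1 Phi) trmx_mul trmxK !mulmxA.
have enorm_le p q (x : 'rV[R]_p) (y : 'rV[R]_q) :
    (x *m x^T) 0 0 <= (y *m y^T) 0 0 -> enorm x <= enorm y.
  by move=> xy; rewrite ler_wsqrtr // !dot_mulmx.
apply/seteqP; split=> y /=; rewrite -mul_tuple_mx.
  move=> [_ [x xr <-]]; rewrite PPhi => yE.
  have -> : y = x *m A^T.
    have := congr1 (mulmxr (tuple_mx e)^T) yE.
    by rewrite /= -[LHS]mulmxA -[RHS]mulmxA EE !mulmx1.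
  rewrite -mulmxA -trmx_mul -/Q; apply: le_lt_trans xr; apply: enorm_le.
  by rewrite (proj_pythagoras x QQ) lerDl mulmx_tr_ge0.
move=> yr; exists (Phi (y *m T^T *m Q)).
  exists (y *m T^T *m Q) => //; apply: le_lt_trans yr; apply: enorm_le.
  by rewrite trmx_mul mulmxA -[_ *m Q *m _]mulmxA QQ mulmx1.
rewrite PPhi; congr (_ *m _).
have : Q *m A^T *m T^T = 1%:M by rewrite -mulmxA -trmx_mul.
by move=> /mulmx1C TQA; rewrite -!(mulmxA y) -(mulmxA T^T) TQA mulmx1.
Qed.

Theorem theorem1 (R : realType) (n k : nat) (r : R)
    (V : {vspace 'rV[R]_(n * 2)}) (Phi P : 'End('rV[R]_(n * 2)))
    (n_ge1 : (1 <= n)%N) (k_bounds : (1 <= k <= n)%N) (r_gt0 : 0 < r)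
    (Phi_sympl : symplectic_automorphism Phi)
    (V_complex : complex_subspace V) (dimV : (\dim V = 2 * k)%N)
    (P_proj : is_orthogonal_projector V P) :
  (omega R (2 * k) * (r ^+ (2 * k))%:E
     <= vol (2 * k) V (P @` (Phi @` eball (n * 2) r)))%E
  /\
  (vol (2 * k) V (P @` (Phi @` eball (n * 2) r))
     = (omega R (2 * k) * (r ^+ (2 * k))%:E)%E
   <-> complex_subspace (adjoint Phi @: V)%VS).
Proof.
have m_gt0 : (0 < 2 * k)%N by case/andP: k_bounds => k0 _; rewrite muln_gt0.
rewrite /vol; set e := xget _ _.
have ebasis : orthonormal_basis V e.
  have [e0 e0basis] := orthonormal_basis_exists dimV.
  exact: (@xgetPex _ _ [set e | orthonormal_basis V e] (ex_intro _ e0 e0basis)).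
have EE := orthonormal_basis_mx ebasis.
set E := tuple_mx e in EE.
pose F := lin1_mx Phi; pose J := imx R n; pose A := E *m F^T.
have FJF : F^T *m J *m F = J.
  by apply: symplectic_tr => x y; rewrite !mul_rV_lin1; exact: Phi_sympl.2.
have Afree : row_free A.
  (* [J F (- J)] is the inverse of [F^T] *)
  apply/row_freeP; exists (J *m F *m (- J) *m E^T).
  have -> : A *m (J *m F *m (- J) *m E^T)
      = E *m ((F^T *m J *m F) *m (- J)) *m E^T by rewrite /A !mulmxA.
  by rewrite FJF mul_imxN mulmx1.
have [T [Ttrig Tdiag QQ _]] := gram_schmidt Afree.
set Q := T *m A in QQ.
rewrite (projected_ball_preimage r P_proj ebasis QQ).
rewrite lebesgue_vol_trig // => [|i]; last by rewrite mxE.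
rewrite det_tr lebesgue_vol_eballZ //; set t := \det T.
have t_gt0 : 0 < t.
  by rewrite /t -det_tr det_trig //; apply: prodr_gt0 => i _; rewrite mxE.
set B := (omega R _ * _)%E.
have B_gt0 : (0 < B)%E by rewrite mule_gt0 ?omega_gt0 // lte_fin exprn_gt0.
have B_fin : B \is a fin_num.
  rewrite fin_numM // ge0_fin_numE ?omega_fin //; exact/ltW/omega_gt0.
have rowspaceQ x : (x <= Q)%MS = (x <= A)%MS.
  by rewrite /Q eqmxMfull // row_full_unit unitmxE unitfE gt_eqF.
have complexE : complex_subspace (adjoint Phi @: V)%VS <-> (Q *m J <= Q)%MS.
  apply: complex_subspace_submx => x; rewrite rowspaceQ.
  have adjE v : adjoint Phi v = v *m F^T by rewrite lfunE.
  split=> [/memv_imgP[v /(mem_basis_submx _ ebasis.1)/submxP[y ->] ->]|].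
    by rewrite adjE -mulmxA submxMl.
  move=> /submxP[y ->]; rewrite mulmxA -adjE; apply: memv_img.
  by apply/(mem_basis_submx _ ebasis.1); exact: submxMl.
have [_ [_ /(_ _)detW]] := det_compression EE (imx_orthogonal R n).
have {detW} detW : \det (E *m J *m E^T) ^+ 2 = 1.
  apply: detW; apply: (iffLR (complex_subspace_submx _) V_complex) => x.
  exact: mem_basis_submx ebasis.1.
have detN : \det (Q *m J *m Q^T) ^+ 2 = t ^+ 4.
  have -> : Q *m J *m Q^T = T *m (E *m J *m E^T) *m T^T.
    by rewrite -{2}FJF /Q /A !trmx_mul trmxK !mulmxA.
  by rewrite !det_mulmx det_tr mulrAC -expr2 exprMn detW mulr1 -exprM.
have [t_le1 t_eq1] := det_compression QQ (imx_orthogonal R n).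
rewrite -/J detN in t_le1 t_eq1.
have {}t_le1 : t <= 1 by rewrite -(expr_le1 (n := 4)) // ltW.
split.
  by rewrite -[leLHS]mul1e lee_pmul2r // lee_fin invf_ge1.
have b_gt0 : 0 < fine B by rewrite fine_gt0 // B_gt0 ltey_eq B_fin.
rewrite complexE -t_eq1 -(fineK B_fin) -EFinM; split=> [[/eqP]|/eqP].
  rewrite -[X in _ == X]mul1r (inj_eq (mulIf (lt0r_neq0 b_gt0))) invr_eq1.
  by move=> /eqP ->; rewrite expr1n.
by rewrite pexpr_eq1 // ?ltW // => /eqP ->; rewrite invr1 mul1r.
Qed.
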